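(* Let $a,b$ be positive integers and let $q > a+b-1$ be an integer. Let $T \in \mathrm{Inc}^q(a\times b)$ and suppose the orbit of $T$ under $K$-promotion $\Psi$ on $\mathrm{Inc}^q(a\times b)$ has cardinality $k$. Then $\gcd(k,q) > 1$.
   Context: $a\times b$ denotes the grid of boxes with $a$ rows and $b$ columns, boxes indexed as matrix entries $(i,j)$. An increasing tableau of shape $a\times b$ is a filling of the boxes by positive integers strictly increasing left to right along rows and top to bottom along columns; $\mathrm{Inc}^q(a\times b)$ is the set of such tableaux with all entries at most $q$. $K$-promotion $\Psi$ on $\mathrm{Inc}^q(a\times b)$ is defined as follows. Given $T$, for $j = 2,3,\dots,q$ in turn: consider the set of boxes currently labeled $1$ or $j$, and split it into edge-connected components (called short ribbons); in each component consisting of more than one box, swap the labels $1$ and $j$ (components consisting of a single box are left unchanged). After doing this for all $j=2,\dots,q$, decrease every label by $1$ and replace any resulting label $0$ by $q$. The result $\Psi(T)$ lies in $\mathrm{Inc}^q(a\times b)$, and $\Psi$ is a permutation of $\mathrm{Inc}^q(a\times b)$; the orbit of $T$ is $\{\Psi^m(T): m\ge 0\}$. *)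

(* Defs.v *)
From mathcomp Require Import all_boot all_fingroup.

Set Implicit Arguments.
Unset Strict Implicit.
Unset Printing Implicit Defensive.

(* Labels are elements of 'I_q.+1 = {0, ..., q}; box coordinates are 0-based.
   Label 0 never occurs in an increasing tableau: [Inc] asks for positive
   entries.  Using a finite label type makes fillings a finType. *)
Notation filling a b q := {ffun 'I_a * 'I_b -> 'I_q.+1}.

Definition Inc (a b q : nat) : {set filling a b q} :=
  [set T : filling a b q |
    [&& [forall u, 0 < T u],
        [forall i : 'I_a, forall j : 'I_b, forall j' : 'I_b,
          (j < j') ==> (T (i, j) < T (i, j'))]
      & [forall j : 'I_b, forall i : 'I_a, forall i' : 'I_a,
          (i < i') ==> (T (i, j) < T (i', j))]]].

Section Promotion.

Variables a b q : nat.
Implicit Types (T : filling a b q) (l : 'I_q.+1) (u v : 'I_a * 'I_b).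

Definition share_edge : rel ('I_a * 'I_b) := fun u v =>
     (u.1 == v.1) && ((u.2.+1 == v.2 :> nat) || (v.2.+1 == u.2 :> nat))
  || (u.2 == v.2) && ((u.1.+1 == v.1 :> nat) || (v.1.+1 == u.1 :> nat)).

Definition label1 : 'I_q.+1 := inord 1.

Definition ribbon_adj T l : rel ('I_a * 'I_b) := fun u v =>
  [&& share_edge u v, T u \in [:: label1; l] & T v \in [:: label1; l]].

(* If [T u] is neither 1 nor l, this is just [set u]. *)
Definition short_ribbon T l u : {set 'I_a * 'I_b} :=
  [set v | connect (ribbon_adj T l) u v].

Definition swap_ribbons T l : filling a b q :=
  [ffun u => if 1 < #|short_ribbon T l u| then tperm label1 l (T u) else T u].

Definition decr_label l : 'I_q.+1 :=
  if l.-1 == 0 then ord_max else inord l.-1.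

Definition Kpromotion T : filling a b q :=
  let T' := foldl swap_ribbons T [seq inord j | j <- index_iota 2 q.+1] in
  [ffun u => decr_label (T' u)].

End Promotion.

(* Main.v *)
Require Import Defs.
From mathcomp Require Import all_boot.
From mathcomp Require Import perm zify.

(** Let [L i j] be the shape formed by the boxes of [Psi^i T] with label at most
    [j - i], where [i <= j <= i + q].  Promotion is a local rule on the squares
    [al = L (i+1) j], [be = L i j], [ga = L (i+1) (j+1)], [de = L i (j+1)]: a box
    of [de] minus [al] lies in exactly one of [be], [ga] if it has no neighbour
    in [de] minus [al], and in both or neither otherwise.  The rule is symmetric
    in [be] and [ga] (so promotion is injective) and under complementation in
    the rectangle.

    The longest chain of boxes with increasing labels and weakly decreasing row
    index is invariant under sliding, which identifies the first row of
    [L j (i + q)] with the complement of the last row of [L i j].  Applied to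
    the complementary growth diagram too, this shows that the first row of
    [Psi^i T] is [q]-periodic in [i].  If [gcd k q = 1] it is therefore constant
    on the orbit; the local rule then forces it to be 1, ..., b and the last
    column to be b, ..., a + b - 1, although the corner carries the label [q]. *)

Set Implicit Arguments.
Unset Strict Implicit.
Unset Printing Implicit Defensive.

(** * Longest chains and sliding *)

(* Shapes are given by their row lengths; [be] minus [al] is a rook strip. *)
Definition strip (al be : nat -> nat) : Prop :=
  forall x, [/\ al x <= be x, be x <= (al x).+1 & be x.+1 <= al x].

(* When row [x] of [de] minus [al] is a single box, the right-hand side says that
   this box has a neighbour above or below in [de] minus [al].  Rows with zero or
   two boxes are settled by the strip conditions. *)
Definition local_rule (al be ga de : nat -> nat) : Prop :=
  forall x, de x = (al x).+1 ->
    (ga x == be x) = (0 < x) && (al x.-1 == al x) || (de x.+1 == de x).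

Section LongestChain.

Variable a : nat.
Implicit Types (h al be ga de : nat -> nat) (p : nat -> nat -> nat).

(** Update of the chain lengths when a new label enters the rows of [S]. For weakly decreasing [h]
    the first row of [S] from [x] on gives the best extension, so the rows after it are ignored. *)
Definition lis_step h (S : pred nat) (x : nat) : nat :=
  foldr (fun y m => if S y then (h y).+1 else maxn (h y) m) 0 (iota x (a - x)).

Lemma lis_step_out h S x : a <= x -> lis_step h S x = 0.
Proof. by rewrite /lis_step -subn_eq0 => /eqP ->. Qed.

Lemma lis_stepE h S x : x < a ->
  lis_step h S x = if S x then (h x).+1 else maxn (h x) (lis_step h S x.+1).
Proof. by move=> xa; rewrite /lis_step -(subnSK xa). Qed.

Lemma lis_step_le h S x : (forall y, h y.+1 <= h y) -> lis_step h S x <= (h x).+1.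
Proof.
move=> hb; have [ax|] := leqP a x; first by rewrite lis_step_out.
move En : (a - x) => n; elim: n x En => [|n IH] x En xa; first lia.
rewrite lis_stepE //; case: ifP => // _.
have [ax1|x1a] := leqP a x.+1; first by rewrite lis_step_out //; lia.
by have := IH x.+1; have := hb x; lia.
Qed.

Lemma lis_step_ge h S x : x < a -> h x <= lis_step h S x.
Proof. by move=> xa; rewrite lis_stepE //; case: ifP; lia. Qed.

(* [lis p n x] is the length of the longest chain of boxes of [p n] minus [p 0]
   with increasing labels and weakly decreasing row indices, all at least [x];
   box [p j.+1] minus [p j] carries label [j]. *)
Fixpoint lis p n : nat -> nat :=
  if n is n'.+1 then lis_step (lis p n') (fun x => p n' x < p n x)
  else fun=> 0.

Lemma lis_out p n x : a <= x -> lis p n x = 0.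
Proof. by case: n => // n; exact: lis_step_out. Qed.

(** The second bound compares drops of [h] with drops of row lengths, in sums to avoid truncated
    subtraction; [lis_shift] records where it is attained. *)
Definition lis_bounded h be : Prop :=
  forall x, h x.+1 <= h x /\ (x.+1 < a -> h x + be x.+1 <= h x.+1 + be x).

Lemma lis_step_bounded h be de : strip be de -> (forall x, a <= x -> h x = 0) ->
  lis_bounded h be -> lis_bounded (lis_step h (fun x => be x < de x)) de.
Proof.
move=> bd h0 hb x; set S := fun x => be x < de x.
have [ax|xa] := leqP a x.
  by rewrite !lis_step_out ?leqW //; split=> //; lia.
have le1 : lis_step h S x.+1 <= (h x.+1).+1.
  by apply: lis_step_le => y; case: (hb y).
have [xb1 xb2] := hb x; have [d1 d2 d3] := bd x; have [e1 e2 e3] := bd x.+1.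
rewrite (lis_stepE _ _ xa).
have [ax1|x1a] := leqP a x.+1.
  by rewrite lis_step_out //; split; lia.
have := lis_stepE h S x1a; have := xb2 x1a.
rewrite /S in le1 *.
by do 2 case: ifP => ?; move=> *; split; lia.
Qed.

Lemma lisP p n : (forall j, j < n -> strip (p j) (p j.+1)) ->
  lis_bounded (fun=> 0) (p 0) -> lis_bounded (lis p n) (p n).
Proof.
move=> st b0; elim: n st => [|n IH] st //=.
apply: lis_step_bounded; first exact: st.
  by move=> x; exact: lis_out.
by apply: IH => j jn; apply: st; lia.
Qed.

(* Relates the chain lengths [h] before and [h'] after a slide whose holes fill
   [be] minus [al]: in a row with a hole they differ by one exactly when the
   row-to-row bound on [h'] is attained just above it. *)
Definition lis_shift h' h al be : Prop :=
  forall x, h x = h' x +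
    [&& 0 < x, al x < be x & h' x.-1 + al x == h' x + al x.-1].

(** Rows are treated from the last one upwards, as [lis_step] at a row looks at the next row. Each
    row is split by whether it has a hole and whether it receives the label before and after the
    slide; [local_rule] settles the rows where a single box could go either way. *)
Lemma lis_shift_step h' h al be ga de :
    (forall x, a <= x -> de x = 0) ->
    strip al be -> strip be de -> strip al ga -> strip ga de ->
    local_rule al be ga de ->
    lis_bounded h' al ->
    lis_shift h' h al be ->
  lis_shift (lis_step h' (fun x => al x < ga x))
            (lis_step h (fun x => be x < de x)) ga de.
Proof.
move=> de0 ab bd ag gd rule hb sh x.
have [ax|] := leqP a x.
  by rewrite !(lis_step_out _ _ ax) de0 // ltn0 andbF.
move En : (a - x) => n; elim: n x En => [|n IH] x En xa; first lia.
have kx := lis_stepE h (fun x => be x < de x) xa.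
have k'x := lis_stepE h' (fun x => al x < ga x) xa.
have k'x_le : lis_step h' (fun x => al x < ga x) x <= (h' x).+1.
  by apply: lis_step_le => y; case: (hb y).
have k'px : 0 < x -> lis_step h' (fun x => al x < ga x) x.-1 =
    if al x.-1 < ga x.-1 then (h' x.-1).+1
    else maxn (h' x.-1) (lis_step h' (fun x => al x < ga x) x).
  by move=> x0; rewrite {1}lis_stepE ?prednK //; lia.
have IHx : lis_step h (fun x => be x < de x) x.+1 =
    lis_step h' (fun x => al x < ga x) x.+1 + (ga x.+1 < de x.+1) *
    (lis_step h' (fun x => al x < ga x) x + ga x.+1 ==
     lis_step h' (fun x => al x < ga x) x.+1 + ga x).
  have [ax1|x1a] := leqP a x.+1; last by rewrite IH //=; lia.
  by rewrite !(lis_step_out _ _ ax1) de0 // ltn0.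
have kx1 : be x.+1 < de x.+1 -> lis_step h (fun x => be x < de x) x.+1 = (h x.+1).+1.
  move=> S1; rewrite lis_stepE ?S1 //.
  by rewrite ltnNge; apply/negP => /de0 e; rewrite e in S1.
move: (lis_step h _ x.+1) (lis_step h' _ x.+1) kx kx1 k'x IHx.
move: (lis_step h _ x) (lis_step h' _ x.-1) (lis_step h' _ x) k'x_le k'px.
move=> k k'p k' k'x_le k'px k1 k'1 kx kx1 k'x IHx.
have {}kx : (be x < de x -> k = (h x).+1) /\ (de x <= be x -> k = maxn (h x) k1).
  by move: kx; case: ltnP.
have {}k'x : (al x < ga x -> k' = (h' x).+1) /\
    (ga x <= al x -> k' = maxn (h' x) k'1).
  by move: k'x; case: ltnP.
have {}k'px : 0 < x -> (al x.-1 < ga x.-1 -> k'p = (h' x.-1).+1) /\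
    (ga x.-1 <= al x.-1 -> k'p = maxn (h' x.-1) k').
  by move=> x0; move: (k'px x0); case: ltnP.
have {}IHx : k1 = k'1 + ((ga x.+1 < de x.+1) && (k' + ga x.+1 == k'1 + ga x)).
  by rewrite IHx mulnb.
have sx := sh x; have sx1 := sh x.+1; rewrite /= in sx1.
have [hx1 hx2] := hb x.
have [ab1 ab2 ab3] := ab x; have [bd1 bd2 bd3] := bd x.
have [ag1 ag2 ag3] := ag x; have [gd1 gd2 gd3] := gd x.
have [ab1' ab2' _] := ab x.+1; have [_ bd2' _] := bd x.+1.
have hpx : 0 < x -> h' x <= h' x.-1 /\ h' x.-1 + al x <= h' x + al x.-1.
  by move=> x0; have := hb x.-1; rewrite prednK // => -[? ?]; split; auto.
have stp : 0 < x -> [/\ al x.-1 <= ga x.-1, ga x.-1 <= (al x.-1).+1,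
   al x.-1 <= be x.-1, be x.-1 <= (al x.-1).+1 & be x.-1 <= de x.-1 /\
   de x.-1 <= (ga x.-1).+1].
  by move=> x0; have [? ? ?] := ab x.-1; have [? ? ?] := ag x.-1;
    have [? ? ?] := bd x.-1; have [? ? ?] := gd x.-1; do !split.
have stq : 0 < x -> [/\ be x <= al x.-1, ga x <= al x.-1, de x <= be x.-1 &
   de x <= ga x.-1].
  by move=> x0; have [_ _] := ab x.-1; have [_ _] := ag x.-1;
    have [_ _] := bd x.-1; have [_ _] := gd x.-1; rewrite prednK.
have rx := rule x.
have rpx : 0 < x -> de x.-1 = (al x.-1).+1 -> ga x.-1 < be x.-1 -> de x != de x.-1.
  move=> x0 e lt; move: (rule _ e); rewrite prednK // (ltn_eqF lt).
  by case: (de x == _); rewrite ?orbT.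
clear rule hb sh ab bd ag gd IH.
have low : k'1 <= k1 by rewrite IHx leq_addr.
(* If the correction in row [x.+1] is 1, then [ga x.+1 < de x.+1 <= ga x] turns its equality into
   [k'1 < k']. *)
have up : k1 <= k'1 \/ k1 <= k'.
  clear -IHx gd3; move: IHx; case: ltnP => /= ?; last by move=> ->; left; lia.
  by case: eqP => [? ->|_ ->]; [right; lia|left; lia].
(* The hole of row [x] has the new label directly below it, so [be x.+1 = al x]. Whether or not row
   [x.+1] has a hole itself, this yields [h x.+1 = h' x]. *)
have top : al x < be x -> de x = be x -> de x.+1 = de x -> k1 = (h' x).+1.
  move=> D0 S0 S1.
  have x1a : x.+1 < a by rewrite ltnNge; apply/negP => /de0; clear -S1 S0 D0; lia.
  have kS : k1 = (h x.+1).+1 by apply: kx1; clear -S1 S0 D0 ab3; lia.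
  rewrite kS sx1; clear - hx1 hx2 x1a S1 S0 D0 ab1' ab2' ab2 bd2' ab3.
  move: (hx2 x1a); case: ltnP => /= ?; last by lia.
  by case: eqP => ?; lia.
clear IHx kx1 sx1.
have eqk : h x = h' x -> be x = de x -> al x = ga x -> k = k'.
  move=> hE S0 S'0; have := kx.2; have := k'x.2; rewrite S0 S'0 hE !leqnn.
  by clear -low up => /(_ isT) ? /(_ isT) ?; case: up; lia.
have eqtop : al x < be x -> de x = be x -> de x.+1 = de x ->
    h x <= (h' x).+1 -> k = k' /\ ga x = de x.
  move=> D0 S0 S1 hle; have k1E := top D0 S0 S1.
  have gE : ga x = be x by clear -D0 S0 S1 gd3 ag2 ab2; lia.
  have := kx.2; have := k'x.1; rewrite gE S0 leqnn D0 => /(_ isT) -> /(_ isT) ->.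
  by clear -k1E hle; lia.
clear top.
have [x0|x0] := posnP x.
  subst x; clear hpx stp stq rpx k'px.
  rewrite ltnn /= addn0 in rx sx *.
  have [D0|D0] : al 0 < be 0 \/ be 0 = al 0 by clear -ab1; lia.
    have [S0|S0] : be 0 < de 0 \/ de 0 = be 0 by clear -bd1; lia.
      have S' : al 0 < ga 0 by clear -D0 S0 ab2 bd2 ag2 gd2; lia.
      by rewrite (kx.1 S0) (k'x.1 S') sx addn0.
    have [S'0|S'0] : ga 0 = al 0 \/ ga 0 = be 0 by clear -ag1 ag2 D0 ab2; lia.
      by rewrite addn0 eqk.
    rewrite S'0 eqxx in rx.
    have S1 : de 1 = de 0.
      by apply/eqP; rewrite -rx // S0; clear -D0 ab2; lia.
    by have [|->] := eqtop D0 S0 S1; rewrite ?sx ?addn0.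
  have [S0|S0] : be 0 < de 0 \/ de 0 = be 0 by clear -bd1; lia.
    have S' : al 0 < ga 0.
      have e : de 0 = (al 0).+1 by clear -D0 S0 bd2; lia.
      have ne : (de 1 == de 0) = false by clear -bd3 D0 S0; lia.
      by move: (rx e); rewrite ne D0; clear -ag1; lia.
    by rewrite (kx.1 S0) (k'x.1 S') sx addn0.
  by rewrite addn0 eqk // ; clear -D0 S0 ag1 gd1; lia.
have [hp1 hp2] := hpx x0; have [sp1 sp2 sp3 sp4 [sp5 sp6]] := stp x0.
have [sq1 sq2 sq3 sq4] := stq x0; have [k'p1 k'p2] := k'px x0.
have {}rpx := rpx x0.
clear hpx stp stq k'px.
rewrite x0 /= in sx rx *.
have [D0|D0] : al x < be x \/ be x = al x by clear -ab1; lia.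
  rewrite D0 /= in sx.
  have [S0|S0] : be x < de x \/ de x = be x by clear -bd1; lia.
    have S' : al x < ga x by clear -D0 S0 ab2 bd2 ag2 gd2; lia.
    have D' : ga x < de x by clear -D0 S0 ag2; lia.
    have gap : ga x.-1 = (al x.-1).+1 \/ (ga x.-1 = al x.-1 /\ (al x).+1 < al x.-1).
      clear -rpx sp1 sp2 sp3 sp4 sp5 sp6 sq1 sq3 D0 S0 ab2 bd2; lia.
    rewrite (kx.1 S0) (k'x.1 S') sx D' /=; rewrite (k'x.1 S') in k'p2.
    clear -gap S' k'p1 k'p2 hp1 hp2 ag2.
    case: gap => [gp|[gp gap]].
      by rewrite k'p1 ?gp //; lia.
    by rewrite k'p2 ?gp //; lia.
  have [S'0|S'0] : ga x = al x \/ ga x = be x by clear -ag1 ag2 D0 ab2; lia.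
    have D' : ga x < de x by clear -D0 S0 S'0; lia.
    have k'E : k' = maxn (h' x) k'1 by apply: k'x.2; rewrite S'0.
    have kE : k = maxn (h x) k1 by apply: kx.2; rewrite S0.
    rewrite D' /=.
    clear -k'E kE low up sx sp1 sp2 k'p1 k'p2 hp1 hp2 D0 sq1 k'x_le S'0.
    have kE2 : k = maxn (h x) k' by case: up; lia.
    rewrite {}kE2 {}sx S'0; clear -k'E sp1 sp2 k'p1 k'p2 hp1 hp2 D0 sq1 k'x_le.
    have [gp|gp] : ga x.-1 = (al x.-1).+1 \/ ga x.-1 = al x.-1 by clear -sp1 sp2; lia.
      by rewrite {}k'p1 ?gp //; clear k'p2 gp sp1 sp2; lia.
    by rewrite {}k'p2 ?gp //; clear k'p1 gp sp1 sp2; lia.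
  have e : de x = (al x).+1 by clear -D0 S0 ab2; lia.
  have S1 : de x.+1 = de x.
    move: (rx e); rewrite S'0 eqxx.
    by have /negPf -> : al x.-1 != al x; [clear -D0 sq1; lia | move/esym/eqP].
  have [|-> ->] := eqtop D0 S0 S1; last by rewrite ltnn addn0.
  by rewrite sx -addn1 leq_add2l leq_b1.
rewrite D0 ltnn /= addn0 in sx rx.
have [S0|S0] : be x < de x \/ de x = be x by clear -bd1; lia.
  have e : de x = (al x).+1 by clear -D0 S0 bd2; lia.
  rewrite (kx.1 S0) sx.
  have [S'|S'] : ga x = al x \/ ga x = (al x).+1 by clear -ag1 ag2; lia.
    have ne : (de x.+1 == de x) = false by clear -bd3 D0 S0; lia.
    have /eqP ap : al x.-1 == al x by move: (rx e); rewrite ne S' eqxx orbF.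
    have gp : ga x.-1 = (al x.-1).+1 by clear -sq4 e ap sp2; lia.
    rewrite k'p1 ?gp // S' e ltnSn /=.
    by clear -hp1 hp2 k'x k'x_le ap S'; have := k'x.2; rewrite S' leqnn => /(_ isT); lia.
  by rewrite S' e ltnn addn0 k'x.1 // S'.
have S' : ga x = al x by clear -D0 S0 gd1 ag1; lia.
by rewrite S' S0 D0 ltnn addn0 eqk // S0 ?D0.
Qed.

(** In a straight shape a chain with increasing labels and weakly decreasing rows has strictly
    increasing columns, so no chain beats row [x] itself. *)
Lemma lis_straight p n : (forall x, p 0 x = 0) ->
    (forall j, j < n -> strip (p j) (p j.+1)) ->
    (forall j x, j <= n -> a <= x -> p j x = 0) ->
  lis p n =1 p n.
Proof.
move=> p0; elim: n => [|n IH] st out x; first by rewrite p0.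
have [ax|] := leqP a x; first by rewrite out // lis_out.
have {}IH : lis p n =1 p n.
  by apply: IH => [j jn|j y jn]; [apply: st|apply: out]; lia.
rewrite /=; move En : (a - x) => m; elim: m x En => [|m IHm] x En xa; first lia.
rewrite lis_stepE // IH; have [s1 s2 s3] := st n (leqnn _) x.
case: ifP => [|/negbT]; first by clear -s2; lia.
have [ax1|x1a] := leqP a x.+1; last rewrite IHm //; last lia.
  by rewrite lis_step_out //; clear -s1; lia.
by clear -s1 s3; lia.
Qed.

(** Equal final row lengths leave no room for a drop in [lis_bounded], so row 0 has the same chain
    length as the last row, where the chain is just the boxes of that row. *)
Lemma lis_full p n c : 0 < a -> (forall x, x < a -> p n x = c) ->
    (forall j, j < n -> strip (p j) (p j.+1)) ->
    lis_bounded (fun=> 0) (p 0) ->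
  lis p n 0 + p 0 a.-1 = c.
Proof.
move=> a0 pc st b0.
have last_row : lis p n a.-1 + p 0 a.-1 = p n a.-1.
  elim: n st {pc} => //= n IH st.
  have {}IH := IH (fun j jn => st j (ltnW jn)).
  rewrite lis_stepE ?prednK // lis_step_out //; have [] := st n (leqnn _) a.-1.
  by case: ifP IH; clear; lia.
have bd := lisP st b0.
have const x : x < a -> lis p n x = lis p n 0.
  elim: x => // x IH xa; rewrite -IH ?(ltnW xa) //.
  have [] := bd x; rewrite !pc ?(ltnW xa) //.
  by move=> h1 /(_ xa); clear -h1; lia.
have a1a : a.-1 < a by rewrite prednK.
by rewrite -(const _ a1a) last_row pc.
Qed.

End LongestChain.

(** * Growth diagrams: complementation and periodicity of the first row *)

Section Growth.

Variables a b q : nat.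
Hypotheses (a_gt0 : 0 < a) (b_gt0 : 0 < b).
Implicit Type L : nat -> nat -> nat -> nat.

(** The properties of an orbit that the argument uses, kept abstract so that they apply to the
    complementary diagram as well. *)
Record growth L : Prop := Growth {
  growth_diag : forall i x, L i i x = 0;
  growth_full : forall i x, x < a -> L i (i + q) x = b;
  growth_out : forall i j x, i <= j <= i + q -> a <= x -> L i j x = 0;
  growth_le : forall i j x, i <= j <= i + q -> L i j x <= b;
  growth_stripR : forall i j, i <= j < i + q -> strip (L i j) (L i j.+1);
  growth_stripC : forall i j, i < j <= i + q -> strip (L i.+1 j) (L i j);
  growth_rule : forall i j, i < j < i + q ->
    local_rule (L i.+1 j) (L i j) (L i.+1 j.+1) (L i j.+1) }.

(** The complement in the rectangle after a half turn, so that row lengths decrease again. *)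
Definition compl_shape (f : nat -> nat) x := if x < a then b - f (a.-1 - x) else 0.

Lemma strip_compl al be : (forall x, be x <= b) ->
  strip al be -> strip (compl_shape be) (compl_shape al).
Proof.
move=> bb st x; rewrite /compl_shape.
have [ax|xa] := leqP a x; first by rewrite ifN // -leqNgt leqW.
have [s1 s2 s3] := st (a.-1 - x); have {}bb := bb (a.-1 - x).
split; [clear -s1; lia | clear -s2; lia |].
case: ifP => // x1a; have [_ _] := st (a.-1 - x.+1).
have -> : (a.-1 - x.+1).+1 = a.-1 - x by clear -x1a; lia.
by clear -bb; lia.
Qed.

(** The half turn exchanges the neighbours above and below, hence the two alternatives of the rule;
    a missing row on one side matches a row of length 0 or [b] on the other. *)
Lemma local_rule_compl al be ga de :
    (forall x, de x <= b) -> (forall x, a <= x -> de x = 0) ->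
    strip al be -> strip be de -> strip al ga -> strip ga de ->
  local_rule al be ga de ->
  local_rule (compl_shape de) (compl_shape be) (compl_shape ga) (compl_shape al).
Proof.
move=> bb out ab bd ag gd rule x.
rewrite /compl_shape; have [ax|xa] := leqP a x; first by [].
have xa1 : (x.-1 < a) by clear -xa; lia.
set y := a.-1 - x => e.
have [ab1 _ _] := ab y; have [bd1 _ _] := bd y.
have [ag1 _ _] := ag y; have [gd1 _ _] := gd y; have by1 := bb y.
have ey : de y = (al y).+1 by clear -e ab1 bd1 by1; lia.
have -> : (b - ga y == b - be y) = (ga y == be y).
  by clear -ab1 ag1 bd1 gd1 by1; apply/eqP/eqP; lia.
rewrite (rule _ ey) orbC xa1; congr (_ || _).
  have [x0|x0] := posnP x.
    have -> : y.+1 = a by rewrite /y x0 subn0 prednK.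
    by rewrite x0 out // ey.
  have -> : a.-1 - x.-1 = y.+1 by rewrite /y; clear -x0 xa; lia.
  by have := bb y.+1; clear -by1 => ?; apply/eqP/eqP; lia.
have [ax1|x1a] := leqP a x.+1.
  have y0 : y = 0 by rewrite /y; clear -ax1; lia.
  rewrite y0 /=; rewrite y0 in ab1 bd1 by1 ey.
  by clear -ab1 bd1 by1 ey; apply/esym/eqP; lia.
have -> : a.-1 - x.+1 = y.-1 by rewrite /y; clear -x1a; lia.
have -> : 0 < y by rewrite /y; clear -x1a; lia.
have := bb y.-1; have [? _ _] := ab y.-1; have [? _ _] := bd y.-1.
by clear -ab1 bd1 by1 ey => ?; apply/eqP/eqP; lia.
Qed.

(* The complementary diagram, transposed and moved by one period so that it is
   again indexed by [j <= l <= j + q]. *)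
Definition growth_dual L : nat -> nat -> nat -> nat :=
  fun j l => compl_shape (L l (j + q)).

Lemma growth_dualP L : growth L -> growth (growth_dual L).
Proof.
case=> [Ld Lf Lo Ll Lr Lc Lu].
split; rewrite /growth_dual.
- by move=> i x; rewrite /compl_shape; case: ifP => // xa; rewrite Lf ?subnn //; lia.
- by move=> i x xa; rewrite /compl_shape xa Ld subn0.
- by move=> i j x _ ax; rewrite /compl_shape ltnNge ax.
- by move=> i j x _; rewrite /compl_shape; case: ifP => // _; rewrite leq_subr.
- by move=> i j ij; apply: strip_compl => [x|]; [apply: Ll|apply: Lc]; lia.
- by move=> i j ij; apply: strip_compl => [x|]; [apply: Ll|apply: Lr]; lia.
move=> i j ij; apply: local_rule_compl => *;
  (apply: Ll || apply: Lo || apply: Lu || apply: Lr || apply: Lc) => //; lia.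
Qed.

Lemma strip_bounded al be : strip al be -> lis_bounded a (fun=> 0) al.
Proof.
move=> st x; split=> // _; rewrite !add0n.
by case: (st x) (st x.+1) => _ _ h [h' _ _]; exact: leq_trans h' h.
Qed.

(** At [n = 0] all chains are empty and a row with a hole cannot attain the bound. At row 0 there is
    no correction term, which makes the longest chain invariant under one promotion. *)
Lemma lis_shift_growth L i j n : growth L -> i < j -> j + n <= i + q ->
  lis_shift (lis a (fun m => L i.+1 (j + m)) n) (lis a (fun m => L i (j + m)) n)
    (L i.+1 (j + n)) (L i (j + n)).
Proof.
move=> gL ij; have [_ _ Lo _ Lr Lc Lu] := gL.
elim: n => [|n IH] jn.
  move=> x; rewrite /= !add0n; have st : strip (L i.+1 (j + 0)) (L i (j + 0)).
    by apply: Lc; lia.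
  case: x => //= x; have [_ _ s] := st x.
  by case: ltnP => //= lt; case: eqP => // e; move: lt; rewrite e ltnNge s.
rewrite /= addnS; apply: lis_shift_step.
- by move=> x ax; apply: Lo => //; lia.
- by apply: Lc; lia.
- by apply: Lr; lia.
- by apply: Lr; lia.
- by apply: Lc; lia.
- by apply: Lu; lia.
- apply: lisP => [m mn|]; first by rewrite addnS; apply: Lr; lia.
  by apply: strip_bounded; apply: Lr; lia.
by apply: IH; lia.
Qed.

(** The longest chain between the indices [j] and [i + q] is computed twice: for [L i] it ends in
    the full rectangle ([lis_full]), for [L j] it starts from the empty shape ([lis_straight]). In
    between lie [j - i] slides. *)
Lemma growth_first_last L i j : growth L -> i <= j <= i + q ->
  L j (i + q) 0 + L i j a.-1 = b.
Proof.
move=> gL ij; have [Ld Lf Lo _ Lr Lc _] := gL.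
set n := i + q - j; have jn : j + n = i + q by rewrite /n; lia.
have slide e : i + e <= j ->
    lis a (fun m => L i (j + m)) n 0 = lis a (fun m => L (i + e) (j + m)) n 0.
  elim: e => [|e IH] ie; first by rewrite addn0.
  have ie' : i + e < j by lia.
  have jn' : j + n <= i + e + q by lia.
  rewrite IH ?addnS; last lia.
  by have := lis_shift_growth gL ie' jn' 0; rewrite addn0.
have stL m : m < n -> strip (L i (j + m)) (L i (j + m.+1)).
  by move=> mn; rewrite addnS; apply: Lr; lia.
have stLj m : m < n -> strip (L j (j + m)) (L j (j + m.+1)).
  by move=> mn; rewrite addnS; apply: Lr; lia.
have lis_j := slide (j - i); rewrite subnKC ?leqnn in lis_j; last lia.
rewrite -jn -(@lis_straight a (fun m => L j (j + m))) //; first last.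
- by move=> m x mn; apply: Lo; lia.
- by move=> x; rewrite addn0 Ld.
rewrite -lis_j // -[in L i j _](addn0 j).
apply: (@lis_full a (fun m => L i (j + m)) n b) => //.
- by move=> x xa; rewrite jn Lf.
have [nq|nq] := ltnP j (i + q).
  by apply: strip_bounded; rewrite addn0; apply: Lr; lia.
have -> : j + 0 = i + q by lia.
by move=> x; split=> // xa; rewrite !Lf //; lia.
Qed.

(** Both first rows are complementary to the last row of [L (j + q) (i + q + q)], one by
    [growth_first_last] for [L] and the other for the dual. The shift in the dual is why only
    starting indices from [q] on are covered. *)
Lemma growth_first_row_periodic L i j : growth L -> i <= j <= i + q ->
  L (i + q) (j + q) 0 = L (i + q + q) (j + q + q) 0.
Proof.
move=> gL ij.
have ij' : j <= i + q <= j + q by lia.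
have := growth_first_last (growth_dualP gL) ij'.
have ij'' : j + q <= i + q + q <= j + q + q by lia.
have := growth_first_last gL ij''.
rewrite /growth_dual /compl_shape a_gt0 subn0 subnn prednK // leqnn.
have [_ _ _ Ll _ _ _] := gL.
have := Ll (i + q) (j + q) 0; have := Ll (j + q) (i + q + q) a.-1.
by clear -ij; lia.
Qed.

(** Once [f] repeats a value it stays there up to [q], where it is [b]; hence [f d = minn d b]. Then
    [corner] follows the last column downwards, one label per row. *)
Lemma growth_const_first_row L (f : nat -> nat) : growth L -> a + b <= q ->
  ~ (forall i d, d <= q -> L i (i + d) 0 = f d).
Proof.
move=> [Ld Lf Lo Ll Lr Lc Lu] abq Lf0.
have f0 : f 0 = 0 by rewrite -(Lf0 0) // addn0 Ld.
have fq : f q = b by rewrite -(Lf0 0) // Lf.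
have fstep d : d < q -> f d <= f d.+1 <= (f d).+1.
  move=> dq; rewrite -!(Lf0 0) ?addnS //; last exact: ltnW.
  have st : strip (L 0 (0 + d)) (L 0 (0 + d).+1) by apply: Lr; lia.
  by have [-> -> _] := st 0.
(* Here [be] and [ga] agree in row 0, so a new box would need a neighbour below; but
   [de 1 <= be 0 < de 0]. *)
have fconcave d : d.+1 < q -> f d.+1 = f d -> f d.+2 = f d.+1.
  move=> dq fd; apply/eqP; rewrite eqn_leq; have := fstep d.+1 dq.
  case/andP=> -> le2; rewrite andbT leqNgt; apply/negP => lt.
  have e : f d.+2 = (f d.+1).+1 by apply/eqP; rewrite eqn_leq le2.
  have := @Lu 0 d.+1 _ 0; have := @Lr 0 d.+1 _ 0.
  have := Lf0 0 d.+1; have := Lf0 0 d.+2; have := Lf0 1 d; have := Lf0 1 d.+1.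
  rewrite !add0n !add1n /= => -> // ; last lia.
  move=> -> //; last lia.
  move=> -> //; move=> -> //; last lia.
  rewrite dq => /(_ isT) [_ _ le1] /(_ isT).
  rewrite e fd eqxx => /(_ erefl)/esym/eqP; rewrite -fd; lia.
have fconst d : d < q -> f d.+1 = f d -> f d = b.
  move=> dq fd; have cst e : d + e < q -> f (d + e) = f d /\ f (d + e).+1 = f d.
    elim: e => [|e IH] de; first by rewrite addn0.
    have [f1 f2] := IH ltac:(lia).
    by rewrite addnS f2 fconcave ?f1 ?f2 // -addnS.
  have [|_] := cst (q - d).-1; first by lia.
  have -> : (d + (q - d).-1).+1 = q by lia.
  by rewrite fq.
have fmin d : d <= q -> f d = minn d b.
  elim: d => [|d IH] dq; first by rewrite f0 min0n.
  have fd := IH (ltnW dq); have := fstep d dq.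
  have [e|ne] := eqVneq (f d.+1) (f d).
    by have := fconst d dq e; lia.
  have : f d.+1 <= b by rewrite -(Lf0 0) // Ll.
  by lia.
have corner x : x <= a -> forall i,
    L i (i + (b + x)) x = b /\ L i (i + (b + x).-1) x = b.-1.
  elim: x => [|x IH] xa i.
    by rewrite addn0 !Lf0 ?fmin ?minnn //; [split=> //|..]; lia.
  have [be _] := IH (ltnW xa) i; have [ga al] := IH (ltnW xa) i.+1.
  have ea : i.+1 + (b + x).-1 = i + (b + x) by lia.
  have ed : i + (b + x.+1) = (i + (b + x)).+1 by lia.
  rewrite ea in al; rewrite addSn in ga.
  have [_ _ cx] : [/\ L i.+1 (i + (b + x)) x <= L i (i + (b + x)) x,
     L i (i + (b + x)) x <= (L i.+1 (i + (b + x)) x).+1 &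
     L i (i + (b + x)) x.+1 <= L i.+1 (i + (b + x)) x].
    by apply: Lc; lia.
  have st : strip (L i (i + (b + x))) (L i (i + (b + x)).+1) by apply: Lr; lia.
  have de : L i (i + (b + x)).+1 x = b.
    have [h _ _] := st x; rewrite be in h; apply/eqP; rewrite eqn_leq h andbT.
    by apply: Ll; lia.
  have := @Lu i (i + (b + x)) _ x.
  rewrite al be ga de eqxx prednK // => rule.
  (* The last box of row [x] lies in both [be] and [ga], so it has a neighbour; [be x <= al x.-1]
     excludes the one above. *)
  have dS : L i (i + (b + x)).+1 x.+1 = b.
    have /esym/orP[/andP[x0 /eqP e]|/eqP //] := rule ltac:(lia) erefl.
    have stc : strip (L i.+1 (i + (b + x))) (L i (i + (b + x))) by apply: Lc; lia.
    have [_ _] := stc x.-1; rewrite prednK // be e; clear -b_gt0; lia.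
  have ep : (b + x.+1).-1 = b + x by lia.
  rewrite ed ep dS; split=> //; have [_ h _] := st x.+1.
  by clear -h dS cx al b_gt0; lia.
(* Row [a] is outside the rectangle, yet [corner] gives it length [b]; [a + b <= q] keeps the index
   in the range of [growth_out]. *)
have [] := corner a (leqnn a) 0.
by rewrite Lo //; lia.
Qed.

End Growth.

(** * The local rule for K-promotion *)

Section Boxes.

Variables a b q : nat.
Hypothesis q_gt1 : 1 < q.
Implicit Types (T : filling a b q) (u v : 'I_a * 'I_b).

Definition covers : rel ('I_a * 'I_b) := fun u v =>
  (u.1 == v.1) && (u.2.+1 == v.2 :> nat) || (u.2 == v.2) && (u.1.+1 == v.1 :> nat).

Definition increasing T :=
  [forall u, 0 < T u] && [forall u, forall v, covers u v ==> (T u < T v)].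

Lemma share_edgeE u v : share_edge u v = covers u v || covers v u.
Proof.
rewrite /share_edge /covers (eq_sym v.1) (eq_sym v.2).
case: (u.1 == v.1); case: (u.2 == v.2); case: (u.2.+1 == v.2 :> nat);
  case: (v.2.+1 == u.2 :> nat); case: (u.1.+1 == v.1 :> nat);
  by case: (v.1.+1 == u.1 :> nat).
Qed.

(** A path to another box of the component has a first edge, so the global ribbons reduce to a
    condition on neighbours. *)
Lemma short_ribbon_gt1 T l u :
  (1 < #|short_ribbon T l u|) = [exists v, ribbon_adj T l u v].
Proof.
apply/card_gt1P/existsP => [[v [w [uv uw vw]]]|[v uv]].
  wlog uw' : v w uv uw vw / u != w.
    move=> wl; have [uw'|] := eqVneq u w; last exact: (wl v w).
    by apply: (wl w v); rewrite // eq_sym // uw'.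
  rewrite inE in uw; case/connectP: uw => -[/= _ e|z p /andP[uz _] _].
    by rewrite e eqxx in uw'.
  by exists z.
exists u, v; split; rewrite ?inE ?connect0 ?connect1 //.
apply: contraTneq uv => <-; rewrite /ribbon_adj /share_edge.
have ne n : (n.+1 == n) = false by rewrite gtn_eqF.
by rewrite !eqxx !ne.
Qed.

Definition partial_promotion T n : filling a b q :=
  foldl (@swap_ribbons a b q) T [seq inord j | j <- index_iota 2 n.+1].

Local Notation w T n u := (nat_of_ord (partial_promotion T n u)).

Definition active T n u := (w T n u == 1) || (w T n u == n.+1).

Lemma partial_promotionS T n u : 0 < n < q ->
  w T n.+1 u =
  if active T n u && [exists v, share_edge u v && active T n v]
  then if w T n u == 1 then n.+1 else 1 else w T n u.
Proof.
case/andP=> n0 nq.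
have -> : partial_promotion T n.+1
        = swap_ribbons (partial_promotion T n) (inord n.+1).
  rewrite /partial_promotion /index_iota.
  have -> : n.+2 - 2 = n.+1 - 2 + 1 by lia.
  rewrite iotaD map_cat foldl_cat /=; congr (swap_ribbons _ (inord _)); lia.
rewrite ffunE short_ribbon_gt1.
have in_act v : (partial_promotion T n v \in [:: @label1 q; inord n.+1]) = active T n v.
  by rewrite !inE -!(inj_eq val_inj) /= !inordK // ltnS // ltnW.
have -> : [exists v, ribbon_adj (partial_promotion T n) (inord n.+1) u v] =
   active T n u && [exists v, share_edge u v && active T n v].
  apply/existsP/andP => [[v /and3P[h1 h2 h3]]|[h1 /existsP[v /andP[h2 h3]]]].
    by split; [rewrite -in_act | apply/existsP; exists v; rewrite h1 -in_act].
  by exists v; apply/and3P; split; rewrite ?in_act.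
case: ifP => // /andP[+ _].
have v1 : nat_of_ord (@label1 q) = 1 by rewrite /= inordK // ltnS ltnW.
have vn : nat_of_ord (inord n.+1 : 'I_q.+1) = n.+1 by rewrite /= inordK.
rewrite /active; case: eqP => [e _|ne /= /eqP e].
  have -> : partial_promotion T n u = label1 q by apply/val_inj; exact: etrans e (esym v1).
  by rewrite tpermL vn.
have -> : partial_promotion T n u = inord n.+1 by apply/val_inj; exact: etrans e (esym vn).
by rewrite tpermR v1.
Qed.

Lemma partial_promotion1 T : partial_promotion T 1 = T.
Proof. by []. Qed.

Lemma partial_promotion_inv T n u : 0 < T u -> 0 < n <= q ->
  if n < T u then w T n u == T u else 0 < w T n u <= n.
Proof.
move=> T0; case: n => // n; elim: n => [|n IH] nq.
  by rewrite partial_promotion1; case: ltnP => //; lia.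
rewrite partial_promotionS; last lia.
have := IH ltac:(lia); rewrite /active.
by case: (ltnP n.+1); case: (ltnP n.+2); case: ifP => //; try case: ifP; lia.
Qed.

(** After stage [d] only 1 and labels above [d] are exchanged. *)
Lemma partial_promotion_stable T n d u : 0 < d <= n -> n <= q ->
  (1 < w T n u <= d) = (1 < w T d u <= d).
Proof.
case/andP=> d0; elim: n => [|n IH] dn nq; first lia.
have [->//|ne] := eqVneq d n.+1.
rewrite -IH; [|lia..]; rewrite partial_promotionS; last lia.
by rewrite /active; case: ifP => //; case: ifP; lia.
Qed.

Lemma val_promotion T u : 0 < T u ->
  Kpromotion T u = (if w T q u == 1 then q else (w T q u).-1) :> nat.
Proof.
move=> T0; have := partial_promotion_inv (n := q) T0.
rewrite (ltnW q_gt1) leqnn ltnNge -ltnS ltn_ord => /(_ isT) /= bd.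
rewrite ffunE /decr_label -/(partial_promotion T q).
have -> : ((partial_promotion T q u).-1 == 0) = (w T q u == 1) by move: bd => /=; lia.
by case: ifP => // _; rewrite /= inordK; lia.
Qed.

Lemma promotion_gt0 T u : 0 < T u -> 0 < Kpromotion T u.
Proof.
move=> T0; have := partial_promotion_inv (n := q) T0; have := val_promotion T0.
rewrite (ltnW q_gt1) leqnn ltnNge -ltnS ltn_ord /= => -> /(_ isT).
by case: ifP; lia.
Qed.

Lemma promotion_ltE T u d : 0 < T u -> 0 < d <= q ->
  (Kpromotion T u < d) = (1 < w T d u <= d).
Proof.
move=> T0 dq; rewrite -(@partial_promotion_stable T q) //.
have := partial_promotion_inv (n := q) T0; have := val_promotion T0.
rewrite (ltnW q_gt1) leqnn ltnNge -ltnS ltn_ord /= => -> /(_ isT).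
by case: ifP; lia.
Qed.

Lemma promotion_lt_le T u d : 0 < T u -> 0 < d <= q ->
  Kpromotion T u < d -> T u <= d.
Proof.
move=> T0 dq; rewrite promotion_ltE //; have := partial_promotion_inv T0 dq.
by case: ltnP => //; lia.
Qed.

(* The boxes that take part in the exchange of the labels 1 and [d.+1]. *)
Definition moving T d u := (T u <= d.+1) && (d <= Kpromotion T u).

(** At stage [d] a moving box carries 1 if [T u <= d] and [d.+1] otherwise. It swaps exactly when it
    has a moving neighbour, and [Kpromotion T u <= d] means that it carries [d.+1] afterwards. *)
Lemma promotion_rule T u d : (forall u, 0 < T u) -> 0 < d < q -> moving T d u ->
  ((Kpromotion T u <= d) == (T u <= d)) = [exists v, share_edge u v && moving T d v].
Proof.
move=> T0 dq.
have mE v : moving T d v = active T d v.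
  rewrite /moving /active leqNgt [d <= _]leqNgt promotion_ltE //; last lia.
  have := partial_promotion_inv (T0 v) (_ : 0 < d <= q); move/(_ ltac:(lia)).
  by case: (ltnP d); lia.
have -> : [exists v, share_edge u v && moving T d v] =
          [exists v, share_edge u v && active T d v].
  by apply: eq_existsb => v; rewrite mE.
rewrite mE => act; rewrite -ltnS promotion_ltE //; last lia.
rewrite partial_promotionS //; rewrite act /=.
have := partial_promotion_inv (T0 u) (_ : 0 < d <= q); move/(_ ltac:(lia)).
move: act; rewrite /active.
case: [exists v, _]; case: (ltnP d (T u)); case: (w T d u =P 1) => /= e1 Tu.
all: rewrite ?e1 ?ltnn ?leqnn /= ?dq; clear -dq e1 Tu T0; try by lia.
Qed.

Lemma increasing_gt0 T u : increasing T -> 0 < T u.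
Proof. by case/andP=> /forallP. Qed.

Lemma increasing_covers T u v : increasing T -> covers u v -> T u < T v.
Proof. by case/andP=> _ /forallP/(_ u)/forallP/(_ v)/implyP. Qed.

(** Otherwise [u] and, by induction, [v] both move at the preceding stage; being neighbours they
    swap, which contradicts the assumed value at [u]. *)
Lemma covers_promotion_lt T u v d : increasing T -> 0 < d <= q -> covers u v ->
  T v <= d -> Kpromotion T u < d.
Proof.
move=> incT + uv; have uv_lt := increasing_covers incT uv.
have T0 x := increasing_gt0 x incT.
case: d => // d; elim: d => [|d IH] dq Tv; first by have := T0 u; lia.
rewrite ltnS leqNgt; apply/negP => lt.
have Tu : T u <= d.+1 by lia.
have mu : moving T d.+1 u by rewrite /moving; lia.
have mv : moving T d.+1 v.
  rewrite /moving Tv /= leqNgt; apply/negP => /promotion_lt_le -/(_ (T0 v) ltac:(lia)).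
  by move/IH => /(_ ltac:(lia)); lia.
have := promotion_rule T0 _ mu; move/(_ ltac:(lia)).
have -> : [exists v, share_edge u v && moving T d.+1 v].
  by apply/existsP; exists v; rewrite share_edgeE uv.
by rewrite Tu leqNgt lt.
Qed.

Lemma covers_promotion_le T u v d : increasing T -> 0 < d < q -> covers u v ->
  Kpromotion T v <= d -> Kpromotion T u < d.
Proof.
move=> incT dq uv Pv; have uv_lt := increasing_covers incT uv.
have T0 x := increasing_gt0 x incT.
have low x : Kpromotion T x < d -> T x <= d by apply: promotion_lt_le => //; lia.
have step := covers_promotion_lt incT (_ : 0 < d <= q) uv.
have [Tv|Tv] := leqP (T v) d; first by apply: step; lia.
have Tv1 : T v <= d.+1 by apply: promotion_lt_le; rewrite // ?ltnS //; lia.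
rewrite ltnNge; apply/negP => Pu.
have mu : moving T d u by rewrite /moving Pu andbT; lia.
have mv : moving T d v.
  by rewrite /moving Tv1 leqNgt; apply/negP => /low; lia.
have := promotion_rule T0 dq mv.
have -> : [exists u, share_edge v u && moving T d u].
  by apply/existsP; exists u; rewrite share_edgeE uv orbT.
by rewrite Pv [T v <= d]leqNgt Tv.
Qed.

Lemma increasing_promotion T : increasing T -> increasing (Kpromotion T).
Proof.
move=> incT; have T0 x := increasing_gt0 x incT; apply/andP; split.
  by apply/forallP => u; apply: promotion_gt0.
apply/forallP => u; apply/forallP => v; apply/implyP => uv.
(* The label [q] arises from 1 and needs its own case; there [T v <= q] is all that is required. *)
have [lt|ge] := ltnP (Kpromotion T v) q.
  by apply: covers_promotion_le (leqnn _); rewrite // promotion_gt0.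
apply: leq_trans ge; apply: covers_promotion_lt uv _; rewrite ?leqnn ?andbT //; first lia.
by rewrite -ltnS.
Qed.

(** The level sets are recovered from [q] downwards: level [d.+1] and the promoted filling determine
    the moving boxes, and [promotion_rule] then gives level [d]. *)
Lemma promotion_inj : {in increasing &, injective (@Kpromotion a b q)}.
Proof.
move=> T1 T2 i1 i2 e.
have T01 x := increasing_gt0 x i1; have T02 x := increasing_gt0 x i2.
have lev n : n < q -> forall u, (T1 u <= q - n) = (T2 u <= q - n).
  elim: n => [|n IH] nq u.
    by rewrite subn0 -!(ltnS _ q) !ltn_ord.
  have {}IH := IH (ltnW nq).
  set d := q - n.+1; have dq : 0 < d < q by rewrite /d; lia.
  have dS : q - n = d.+1 by rewrite /d; lia.
  rewrite dS in IH.
  have mE v : moving T1 d v = moving T2 d v by rewrite /moving IH e.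
  have [m1|] := boolP (moving T1 d u).
    have := promotion_rule T02 dq (_ : moving T2 d u); rewrite -mE => /(_ m1).
    have := promotion_rule T01 dq m1.
    have -> : [exists v, share_edge u v && moving T1 d v] =
              [exists v, share_edge u v && moving T2 d v].
      by apply: eq_existsb => v; rewrite mE.
    by move=> <-; rewrite e; do 3 case: (_ <= d).
  rewrite /moving negb_and; case/orP => [|lt].
    by move=> ge; have := ge; rewrite IH; lia.
  rewrite -ltnNge in lt; have dq' : 0 < d <= q by clear -dq; lia.
  have -> : T1 u <= d by exact: promotion_lt_le lt.
  by rewrite e in lt; rewrite (promotion_lt_le _ _ lt).
apply/ffunP => u; apply/ord_inj/eqP; rewrite eqn_leq.
have le U : increasing U -> exists2 n, n < q & U u = q - n :> nat.
  move=> iU; exists (q - U u); have := increasing_gt0 u iU; have := ltn_ord (U u); lia.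
have [n1 h1 e1] := le _ i1; have [n2 h2 e2] := le _ i2.
by rewrite {1}e2 lev // -e2 leqnn /= {1}e1 -lev // -e1 leqnn.
Qed.

End Boxes.

(** * The growth diagram of an orbit *)

Lemma count_prefix (P : pred nat) b c :
    (forall c, P c.+1 -> P c) -> (forall c, P c -> c < b) ->
  (c < count P (iota 0 b)) = P c.
Proof.
move=> Pdown Pb.
have [n Pn] : exists n, P =1 (fun c => c < n).
  have exn : exists n, ~~ P n by exists b; apply/negP => /Pb; rewrite ltnn.
  exists (ex_minn exn); case: ex_minnP => n Pn nmin m.
  have [mn|nm] := ltnP m n.
    by apply/negPn/negP => /nmin; rewrite leqNgt mn.
  apply/negP => Pm; move/negP: Pn; apply; move: Pm.
  by rewrite -(subnKC nm); elim: (m - n) => [|e IH]; rewrite ?addn0 // addnS => /Pdown.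
rewrite Pn (eq_count Pn) -size_filter.
have nb : n <= b by case: n Pn => // n Pn; apply: Pb; rewrite Pn.
by rewrite (@filter_iota_ltn 0 b n nb) size_iota.
Qed.

Lemma strip_count (P Q : nat -> pred nat) b :
    (forall x c, P x c.+1 -> P x c) -> (forall x c, Q x c.+1 -> Q x c) ->
    (forall x c, Q x c -> c < b) ->
    (forall x c, P x c -> Q x c) ->
    (forall x c, Q x c.+1 -> P x c) -> (forall x c, Q x.+1 c -> P x c) ->
  strip (fun x => count (P x) (iota 0 b)) (fun x => count (Q x) (iota 0 b)).
Proof.
move=> Pd Qd Qb PQ QPr QPd x.
have Pb y c : P y c -> c < b by move=> /PQ /Qb.
have pE y c : (c < count (P y) (iota 0 b)) = P y c by apply: count_prefix; [apply: Pd|apply: Pb].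
have qE y c : (c < count (Q y) (iota 0 b)) = Q y c by apply: count_prefix; [apply: Qd|apply: Qb].
split; first by apply: sub_count => c; exact: PQ.
  by rewrite leqNgt qE; apply/negP => /QPr; rewrite -pE ltnn.
by rewrite leqNgt qE; apply/negP => /QPd; rewrite -pE ltnn.
Qed.

Section Shapes.

Variables a b q : nat.
Hypothesis q_gt1 : 1 < q.
Implicit Types (T : filling a b q) (u v : 'I_a * 'I_b).

(* Positions outside the grid get the junk value [q.+1], above every label. *)
Definition entry T x c : nat :=
  if insub x is Some i then
    if insub c is Some j then nat_of_ord (T (i, j)) else q.+1
  else q.+1.

Lemma entry_in T u : entry T u.1 u.2 = T u.
Proof. by case: u => i j; rewrite /entry !valK. Qed.

Lemma entry_le T x c d : entry T x c <= d -> d <= q ->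
  exists u, [/\ x = u.1, c = u.2 & T u <= d].
Proof.
rewrite /entry; case: insubP => [i _ <-|_ h1 h2]; last lia.
case: insubP => [j _ <-|_ h1 h2]; last lia.
by exists (i, j).
Qed.

Lemma entry_right_le T x c d : entry T x c.+1 <= d -> d <= q ->
  exists u v, [/\ covers u v, forall U, entry U x c = U u & T v <= d].
Proof.
move=> le dq; have [[i j] /= [-> cj Tu]] := entry_le le dq.
have cb : c < b by have := ltn_ord j; lia.
exists (i, Ordinal cb), (i, j); split=> // [|U]; last by rewrite -entry_in.
by rewrite /covers /= eqxx cj eqxx.
Qed.

Lemma entry_down_le T x c d : entry T x.+1 c <= d -> d <= q ->
  exists u v, [/\ covers u v, forall U, entry U x c = U u & T v <= d].
Proof.
move=> le dq; have [[i j] /= [xi -> Tu]] := entry_le le dq.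
have xa : x < a by have := ltn_ord i; lia.
exists (Ordinal xa, j), (i, j); split=> // [|U]; last by rewrite -entry_in.
by rewrite /covers /= eqxx xi eqxx orbT.
Qed.

Lemma entry_right T x c d : increasing T -> d < q ->
  entry T x c.+1 <= d.+1 -> entry T x c <= d.
Proof.
move=> iT dq /entry_right_le-/(_ dq)[u [v [uv -> Tv]]].
by rewrite -ltnS; apply: leq_trans Tv; apply: increasing_covers.
Qed.

Lemma entry_down T x c d : increasing T -> d < q ->
  entry T x.+1 c <= d.+1 -> entry T x c <= d.
Proof.
move=> iT dq /entry_down_le-/(_ dq)[u [v [uv -> Tv]]].
by rewrite -ltnS; apply: leq_trans Tv; apply: increasing_covers.
Qed.

Definition shape T d x := count (fun c => entry T x c <= d) (iota 0 b).

Lemma entry_row T x c d : increasing T -> d <= q ->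
  entry T x c.+1 <= d -> entry T x c <= d.
Proof.
case: d => [|d] iT dq h; last by apply: leqW; apply: entry_right h.
by have [u [_ _]] := entry_le h dq; rewrite leqNgt increasing_gt0.
Qed.

Lemma shapeE T d x c : increasing T -> d <= q ->
  (c < shape T d x) = (entry T x c <= d).
Proof.
move=> iT dq; apply: count_prefix => {}c; first exact: entry_row.
by case/entry_le => // u [_ -> _].
Qed.

Lemma strip_shape T d : increasing T -> d < q -> strip (shape T d) (shape T d.+1).
Proof.
move=> iT dq; apply: strip_count => x c; [apply: entry_row|apply: entry_row| | | |] => //.
- exact: ltnW.
- by case/entry_le => // u [_ -> _].
- exact: leqW.
- exact: entry_right.
exact: entry_down.
Qed.

Lemma shape_le T d x : shape T d x <= b.
Proof. by rewrite (leq_trans (count_size _ _)) ?size_iota. Qed.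

Lemma strip_promotion T d : increasing T -> d < q ->
  strip (shape (Kpromotion T) d) (shape T d.+1).
Proof.
move=> iT dq; have iT' := increasing_promotion q_gt1 iT.
have dq1 : 0 < d.+1 <= q by [].
apply: strip_count => x c.
- exact/entry_row/ltnW.
- exact: entry_row.
- by case/entry_le => // u [_ -> _].
- case/entry_le => [|u [-> -> ?]]; first exact: ltnW.
  by rewrite entry_in; apply: promotion_lt_le; rewrite // increasing_gt0.
- case/entry_right_le => // u [v [uv -> Tv]].
  by rewrite -ltnS; apply: covers_promotion_lt uv Tv.
case/entry_down_le => // u [v [uv -> Tv]].
by rewrite -ltnS; apply: covers_promotion_lt uv Tv.
Qed.

Lemma moving_shape T d u : increasing T -> 0 < d < q ->
  moving T d u = (shape (Kpromotion T) d.-1 u.1 <= u.2 < shape T d.+1 u.1).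
Proof.
case: d => // d iT dq; have iT' := increasing_promotion q_gt1 iT.
by rewrite leqNgt !shapeE //; [rewrite !entry_in -ltnNge andbC | lia].
Qed.

Lemma shape_rule T d : increasing T -> 0 < d < q ->
  local_rule (shape (Kpromotion T) d.-1) (shape T d) (shape (Kpromotion T) d) (shape T d.+1).
Proof.
move=> iT dq x; have iT' := increasing_promotion q_gt1 iT.
have dq' : d.-1 < q /\ d < q by lia.
have mvE u := moving_shape u iT dq.
have ab : strip (shape (Kpromotion T) d.-1) (shape T d).
  by have := strip_promotion iT dq'.1; rewrite prednK //; case/andP: dq.
have bd := strip_shape iT dq'.2.
have ag : strip (shape (Kpromotion T) d.-1) (shape (Kpromotion T) d).
  by have := strip_shape iT' dq'.1; rewrite prednK //; case/andP: dq.
have gaE c : (c < shape (Kpromotion T) d x) = (entry (Kpromotion T) x c <= d).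
  by apply: shapeE => //; lia.
have beE c : (c < shape T d x) = (entry T x c <= d) by apply: shapeE => //; lia.
have deE c y : (c < shape T d.+1 y) = (entry T y c <= d.+1).
  by apply: shapeE => //; lia.
move: {mvE}(shape _ d.-1) (shape T d) (shape _ d) (shape T d.+1)
  mvE ab bd ag gaE beE deE => al be ga de mvE ab bd ag gaE beE deE e.
have [ab1 ab2 ab3] := ab x; have [bd1 bd2 bd3] := bd x; have [ag1 ag2 ag3] := ag x.
have : al x < de x by rewrite e.
rewrite deE => /entry_le[|u [xu cu Tu]]; first lia.
have mu : moving T d u by rewrite mvE -xu -cu e leqnn /=.
have T0 v : 0 < T v by exact: increasing_gt0.
transitivity ((Kpromotion T u <= d) == (T u <= d)).
  rewrite -!entry_in -xu -cu -gaE -beE.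
  by clear -ab1 ab2 ag1 ag2; apply/eqP/eqP; lia.
rewrite (promotion_rule q_gt1 T0 dq mu); apply/existsP/orP.
  case=> v /andP[uv]; rewrite mvE => /andP[v1 v2].
  (* The neighbour is to the right, to the left, below or above; the first two fail because row [x]
     holds a single box. *)
  case/orP: uv => /andP[/eqP uv /orP[]/eqP vE].
  - by move: v2; rewrite -uv -vE -xu -cu e ltnn.
  - by move: v1; rewrite -uv -xu cu -vE ltnn.
  - right; move: v2; rewrite -uv -vE -xu -cu.
    by clear -ab2 bd3 e; lia.
  left; move: v1; rewrite -uv -cu xu -vE /= => le.
  have [_ _ s1] := ab v.1; have [h _ _] := ab v.1.+1.
  by rewrite eqn_leq le (leq_trans h s1).
case=> [/andP[x0 /eqP e']|/eqP e'].
  have x1a : x.-1 < a by have := ltn_ord u.1; rewrite -xu; clear; lia.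
  exists (Ordinal x1a, u.2); rewrite mvE /= -cu e' leqnn /=.
  rewrite /share_edge /= eqxx -xu prednK // eqxx !orbT /=.
  have [_ _] := bd x.-1; rewrite prednK // e => h.
  by have [h' _ _] := bd x.-1; exact: leq_trans h h'.
have lt : al x < de x.+1 by rewrite e' e.
have [|v [xv cv _]] := entry_le (etrans (esym (deE _ _)) lt); first lia.
exists v; rewrite mvE -xv -cv lt /share_edge -xu -cu -xv -cv /=.
have [h _ _] := ab x.+1; rewrite (leq_trans h ab3) andbT.
by rewrite -(inj_eq val_inj u.2) /= -cu -cv !eqxx /= orbT.
Qed.

Definition orbit_shape T i j := shape (iter i (@Kpromotion a b q) T) (j - i).

Lemma orbit_growth T : increasing T -> growth a b q (orbit_shape T).
Proof.
move=> iT; have iTn n : increasing (iter n (@Kpromotion a b q) T).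
  by elim: n => //= n; apply: increasing_promotion.
rewrite /orbit_shape; split.
- move=> i x; rewrite subnn; apply/eqP; rewrite -leqn0 leqNgt shapeE //.
  apply/negP => /entry_le-/(_ isT)[u [_ _]].
  by rewrite leqNgt increasing_gt0.
- move=> i x xa; rewrite addKn; apply/eqP; rewrite eqn_leq.
  rewrite shape_le /= leqNgt; apply/negP => lt.
  have := ltnn (shape (iter i (@Kpromotion a b q) T) q x); rewrite shapeE // => /negP.
  rewrite -[x]/(nat_of_ord (Ordinal xa)) -[shape _ _ _]/(nat_of_ord (Ordinal lt)).
  by rewrite (entry_in _ (Ordinal xa, Ordinal lt)) -ltnS ltn_ord.
- move=> i j x ij ax; apply/eqP; rewrite -leqn0 leqNgt shapeE; [|by []|lia].
  apply/negP => /entry_le[|u [xu _ _]]; first lia.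
  by have := ltn_ord u.1; rewrite -xu ltnNge ax.
- by move=> *; exact: shape_le.
- by move=> i j ij; rewrite subSn ?(andP ij).1 //; apply: strip_shape => //; lia.
- move=> i j ij; have -> : j - i = (j - i.+1).+1 by lia.
  by apply: (strip_promotion (iTn i)); lia.
move=> i j ij; have -> : j.+1 - i = (j - i).+1 by lia.
have -> : j.+1 - i.+1 = j - i by lia.
have -> : j - i.+1 = (j - i).-1 by lia.
by apply: (shape_rule (iTn i)); lia.
Qed.

End Shapes.

(** * Orbit length and its gcd with [q] *)

Lemma increasing_Inc a b q (T : filling a b q) : T \in Inc a b q -> increasing T.
Proof.
rewrite inE => /and3P[pos row col]; rewrite /increasing pos /=.
apply/forallP => -[i j]; apply/forallP => -[i' j']; apply/implyP.
case/orP => /= /andP[/eqP <- /eqP e].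
  by move/forallP/(_ i)/forallP/(_ j)/forallP/(_ j')/implyP: row; apply; rewrite -e.
by move/forallP/(_ j)/forallP/(_ i)/forallP/(_ i')/implyP: col; apply; rewrite -e.
Qed.

Theorem theorem2p4 (a b q k : nat) (a_gt0 : 0 < a) (b_gt0 : 0 < b)
    (q_gt : a + b - 1 < q) (T : filling a b q) (T_Inc : T \in Inc a b q)
    (card_orbit : #|orbit (@Kpromotion a b q) T| = k) :
  1 < gcdn k q.
Proof.
have q_gt1 : 1 < q by lia.
have iT := increasing_Inc T_Inc.
have abq : a + b <= q by lia.
have gL := orbit_growth q_gt1 iT; set L := orbit_shape T in gL.
have ordE : order (@Kpromotion a b q) T = k.
  by rewrite -card_orbit (card_uniqP (orbit_uniq _ _)) size_orbit.
have k0 : 0 < k by rewrite -ordE order_gt0.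
have perk : iter k (@Kpromotion a b q) T = T.
  rewrite -ordE; apply: (@iter_order_in _ _ (@increasing a b q)) => //.
    by move=> U; apply: increasing_promotion.
  exact: promotion_inj.
rewrite ltn_neqAle gcdn_gt0 k0 andbT eq_sym; apply/negP => /eqP g1.
(* Bezout: [u * k = v * q + 1], so [u] turns of the orbit are [v] periods of the first row plus one
   promotion. *)
have [u v uv _] := egcdnP q k0; rewrite g1 in uv.
case: (growth_const_first_row a_gt0 b_gt0 gL (f := fun d => L 0 d 0) abq) => i d dq.
have perk_m m i' : L (i' + m * k) (i' + m * k + d) 0 = L i' (i' + d) 0.
  rewrite /L /orbit_shape !addKn iterD; congr (shape _ _ _); congr (iter _ _ _).
  by elim: m => // m IH; rewrite mulSn iterD IH.
have perq_m m i' : q <= i' -> L (i' + m * q) (i' + m * q + d) 0 = L i' (i' + d) 0.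
  move=> qi; elim: m => [|m IH]; first by rewrite addn0.
  have := growth_first_row_periodic (i := i' - q + m * q)
    (j := i' - q + m * q + d) a_gt0 b_gt0 gL.
  have -> : i' - q + m * q + q = i' + m * q by lia.
  have -> : i' - q + m * q + d + q = i' + m * q + d by lia.
  move=> /(_ ltac:(lia)); rewrite IH => ->; rewrite mulSn; congr (L _ _ _); lia.
elim: i => // i <-.
(* Adding [q * k] to the indices changes nothing and brings them into the range where [perq_m]
   applies. *)
rewrite -(perk_m q i.+1) -(perk_m q i) -(perk_m u (i + q * k)).
rewrite uv -(perq_m v (i.+1 + q * k)); last by nia.
congr (L _ _ _); lia.
Qed.
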